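(* Let $m=8+12q$ with $q=3+4d$ for a nonnegative integer $d$. The minimal decomposition of $\mathbb{Z}_2$ for the Fibonacci polynomial $F_m$ is $$\mathbb{Z}_2=\{0\}\sqcup\Bigl(\bigcup_{k=0}^{7}M_k\Bigr)\sqcup(2\mathbb{Z}_2-\{0\}),$$ where $M_k=(1+2k+2^5\mathbb{Z}_2)\cup(29+22k+20k^2+24k^3+2^5\mathbb{Z}_2)$. Here $\{0\}$ is the set of a fixed point, the $M_k$'s are the minimal components, and the set $2\mathbb{Z}_2-\{0\}$ is the attracting basin of the fixed point $0$.
   Context: $\mathbb{Z}_2$ is the ring of 2-adic integers with the 2-adic metric. The Fibonacci polynomials are defined by $F_0(x)=0$, $F_1(x)=1$, $F_m(x)=xF_{m-1}(x)+F_{m-2}(x)$ for $m\ge 2$. For a polynomial $f$ over $\mathbb{Z}_2$, a minimal decomposition of $\mathbb{Z}_2$ for $f$ is a decomposition $\mathbb{Z}_2=\mathcal P\sqcup\mathcal M\sqcup\mathcal B$ (some parts possibly empty) in which: $\mathcal P$ is the finite set consisting of all periodic points of $f$; $\mathcal M=\bigsqcup_i\mathcal M_i$ is the union of all (at most countably many) clopen $f$-invariant sets $\mathcal M_i$ (the minimal components), each a finite union of balls, such that each $f:\mathcal M_i\to\mathcal M_i$ is minimal (every orbit is dense in $\mathcal M_i$); and each point of $\mathcal B$ lies in the attracting basin of a periodic orbit or of a minimal subsystem. A point $x$ lies in the attracting basin of a set $C$ (a periodic orbit or minimal component) if the distance from $f^n(x)$ to $C$ tends to $0$ as $n\to\infty$;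 when a part $\mathcal B$ of a decomposition is said to be the attracting basin of $C$, this means every point of $\mathcal B$ lies in the attracting basin of $C$ (the points of $C$ being listed separately). *)

(* Defs.v *)
From HB Require Import structures.
From mathcomp Require Import all_boot all_order all_algebra.
From mathcomp Require Import all_classical all_reals all_analysis.

Set Implicit Arguments.
Unset Strict Implicit.
Unset Printing Implicit Defensive.

Import Order.TTheory GRing.Theory Num.Theory.

Local Open Scope classical_set_scope.
Local Open Scope ring_scope.

(* The ring of 2-adic integers, as the inverse limit of the rings Z/2^n:
   [res x n] is the representative in [0, 2^n) of the class of x modulo 2^n. *)
Record Z2 := MkZ2 {
  res : nat -> nat;
  resS : forall n, res n = (res n.+1 %% 2 ^ n)%N }.

Lemma Z2P (x y : Z2) : res x =1 res y -> x = y.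
Proof.
case: x y => [r rP] [s sP] /= /funext rs; move: rP sP.
by rewrite rs => rP sP; congr MkZ2; apply: Prop_irrelevance.
Qed.

Lemma modXS a n : (a %% 2 ^ n.+1 %% 2 ^ n = a %% 2 ^ n)%N.
Proof. by rewrite modn_dvdm // dvdn_exp2l. Qed.

Lemma res_mod x n : (res x n %% 2 ^ n = res x n)%N.
Proof. by rewrite resS modn_mod. Qed.

Lemma res0n x : res x 0 = 0%N.
Proof. by rewrite resS expn0 modn1. Qed.

Fact Z2_nat_subproof (a n : nat) :
  (a %% 2 ^ n = a %% 2 ^ n.+1 %% 2 ^ n)%N.
Proof. by rewrite modXS. Qed.

Definition Z2_nat a := MkZ2 (Z2_nat_subproof a).

Fact Z2_add_subproof x y n : ((res x n + res y n) %% 2 ^ n =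
  (res x n.+1 + res y n.+1) %% 2 ^ n.+1 %% 2 ^ n)%N.
Proof. by rewrite modXS (resS x) (resS y) modnDm. Qed.

Definition Z2_add x y := MkZ2 (Z2_add_subproof x y).

Fact Z2_mul_subproof x y n : ((res x n * res y n) %% 2 ^ n =
  (res x n.+1 * res y n.+1) %% 2 ^ n.+1 %% 2 ^ n)%N.
Proof. by rewrite modXS (resS x) (resS y) modnMm. Qed.

Definition Z2_mul x y := MkZ2 (Z2_mul_subproof x y).

Lemma res_lt x n : (res x n < 2 ^ n)%N.
Proof. by rewrite -res_mod ltn_mod expn_gt0. Qed.

Fact Z2_opp_subproof x n : ((2 ^ n - res x n) %% 2 ^ n =
  (2 ^ n.+1 - res x n.+1) %% 2 ^ n.+1 %% 2 ^ n)%N.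
Proof.
rewrite modXS; apply/eqP; rewrite -(eqn_modDr (res x n.+1)).
rewrite subnK; last exact/ltnW/res_lt.
rewrite -modnDmr -resS subnK; last exact/ltnW/res_lt.
by rewrite expnS modnn modnMl.
Qed.

Definition Z2_opp x := MkZ2 (Z2_opp_subproof x).

Fact Z2_addA : associative Z2_add.
Proof. by move=> x y z; apply: Z2P => n /=; rewrite modnDml modnDmr addnA. Qed.

Fact Z2_addC : commutative Z2_add.
Proof. by move=> x y; apply: Z2P => n /=; rewrite addnC. Qed.

Fact Z2_add0 : left_id (Z2_nat 0) Z2_add.
Proof. by move=> x; apply: Z2P => n /=; rewrite mod0n add0n res_mod. Qed.

Fact Z2_addN : left_inverse (Z2_nat 0) Z2_opp Z2_add.
Proof.
move=> x; apply: Z2P => n /=.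
by rewrite modnDml subnK ?modnn ?mod0n //; exact/ltnW/res_lt.
Qed.

Fact Z2_mulA : associative Z2_mul.
Proof. by move=> x y z; apply: Z2P => n /=; rewrite modnMml modnMmr mulnA. Qed.

Fact Z2_mulC : commutative Z2_mul.
Proof. by move=> x y; apply: Z2P => n /=; rewrite mulnC. Qed.

Fact Z2_mul1 : left_id (Z2_nat 1) Z2_mul.
Proof. by move=> x; apply: Z2P => n /=; rewrite modnMml mul1n res_mod. Qed.

Fact Z2_mulDl : left_distributive Z2_mul Z2_add.
Proof.
by move=> x y z; apply: Z2P => n /=; rewrite modnMml modnDm mulnDl.
Qed.

HB.instance Definition _ := gen_eqMixin Z2.
HB.instance Definition _ := gen_choiceMixin Z2.
HB.instance Definition _ :=
  GRing.isZmodule.Build Z2 Z2_addA Z2_addC Z2_add0 Z2_addN.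

Fact Z2_1neq0 : Z2_nat 1 != 0 :> Z2.
Proof. by apply/eqP => /(congr1 (fun x => res x 1)). Qed.

HB.instance Definition _ := GRing.Zmodule_isComNzRing.Build Z2
  Z2_mulA Z2_mulC Z2_mul1 Z2_mulDl Z2_1neq0.
HB.instance Definition _ := isPointed.Build Z2 0.

Lemma res0 n : res 0 n = 0%N. Proof. exact: mod0n. Qed.

Lemma resD x y n : res (x + y) n = ((res x n + res y n) %% 2 ^ n)%N.
Proof. by []. Qed.

Lemma resN x n : res (- x) n = ((2 ^ n - res x n) %% 2 ^ n)%N.
Proof. by []. Qed.

Lemma resM x y n : res (x * y) n = ((res x n * res y n) %% 2 ^ n)%N.
Proof. by []. Qed.

Lemma res_eq0_le x m n : (m <= n)%N -> res x n = 0%N -> res x m = 0%N.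
Proof.
move=> /subnK <-; elim: (n - m)%N => // k IH.
by rewrite addSn => h; apply: IH; rewrite resS h mod0n.
Qed.

Lemma res_sub_eq0 x y n : (res (x - y) n == 0%N) = (res x n == res y n).
Proof.
apply/eqP/eqP => [h|h].
  by rewrite -(subrK y x) resD h add0n res_mod.
by rewrite resD h -resD subrr res0.
Qed.

(* The 2-adic absolute value 2^(-v(x)): as 2^n divides x iff [res x n] is 0,
   v(x) is the least n such that [res x n.+1] is nonzero. *)
Definition abs2 (R : realType) (x : Z2) : R :=
  if pselect (exists n, res x n.+1 != 0%N) is left h
  then 2 ^- ex_minn h else 0.

Lemma abs2_le (R : realType) (x : Z2) n :
  (abs2 R x <= 2 ^- n) = (res x n == 0%N).
Proof.
rewrite /abs2; case: pselect => [h|h]; last first.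
  rewrite invr_ge0 exprn_ge0 //; apply/esym/eqP.
  case: n => [|n]; first exact: res0n.
  by apply/eqP; apply: contra_notT h => hn; exists n.
case: ex_minnP => m hm mmin.
rewrite lef_pV2 ?posrE ?exprn_gt0 // ler_eXn2l ?ltr1n //.
apply/idP/eqP => [nm|hn].
  case: n nm => [_|n nm]; first exact: res0n.
  by apply/eqP; apply: contraTT nm => /mmin; rewrite -leqNgt.
rewrite leqNgt; apply: contra hm => mn; apply/eqP.
exact: res_eq0_le mn hn.
Qed.

Lemma abs2_ge0 (R : realType) (x : Z2) : 0 <= abs2 R x.
Proof. by rewrite /abs2; case: pselect => // h; rewrite invr_ge0 exprn_ge0. Qed.

Lemma abs2_eq0 (R : realType) (x : Z2) : abs2 R x = 0 -> x = 0.
Proof.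
move=> x0; apply: Z2P => n; rewrite res0; apply/eqP.
by rewrite -(abs2_le R) x0 invr_ge0 exprn_ge0.
Qed.

Lemma abs2_max (R : realType) (x y z : Z2) :
  (forall n, res x n = 0%N -> res y n = 0%N -> res z n = 0%N) ->
  abs2 R z <= Num.max (abs2 R x) (abs2 R y).
Proof.
move=> xyz; rewrite {1}/abs2; case: pselect => [h|h]; last first.
  by rewrite le_max abs2_ge0.
case: ex_minnP => m hm _; rewrite leNgt gt_max; apply/negP => /andP[].
have lt_res u : abs2 R u < 2 ^- m -> res u m.+1 = 0%N.
  rewrite /abs2; case: pselect => [hu|hu _]; last first.
    by apply/eqP; apply: contra_notT hu => hu; exists m.
  case: ex_minnP => k hk kmin.
  rewrite ltf_pV2 ?posrE ?exprn_gt0 // ltr_eXn2l ?ltr1n // => mk.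
  by apply/eqP; apply: contraTT mk => /kmin; rewrite -leqNgt.
by move=> /lt_res hx /lt_res hy; rewrite (xyz _ hx hy) in hm.
Qed.

Lemma abs2N (R : realType) (x : Z2) : abs2 R (- x) = abs2 R x.
Proof.
have resN0 (u : Z2) n : res u n = 0%N -> res (- u) n = 0%N.
  by move=> u0; rewrite resN u0 subn0 modnn.
have le u : abs2 R (- u) <= abs2 R u.
  by rewrite -[leRHS]maxxx; apply: abs2_max => n /resN0.
by apply/eqP; rewrite eq_le le -{1}(opprK x) le.
Qed.

Lemma abs2D (R : realType) (x y : Z2) : abs2 R (x + y) <= abs2 R x + abs2 R y.
Proof.
apply: (@le_trans _ _ (Num.max (abs2 R x) (abs2 R y))).
  by apply: abs2_max => n x0 y0; rewrite resD x0 y0 mod0n.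
by rewrite ge_max lerDl lerDr !abs2_ge0.
Qed.

Lemma abs20 (R : realType) : abs2 R 0 = 0.
Proof. by rewrite /abs2; case: pselect => // h; have [n] := h; rewrite res0. Qed.

Definition dist2 (R : realType) (x y : Z2) : R := abs2 R (x - y).

Definition ball2 (R : realType) (x : Z2) (e : R) : set Z2 :=
  [set y | dist2 R x y < e].

(* The uniform structure generated by the congruences modulo 2^n; it does not
   mention R, and is the one induced by [dist2 R] for every R (see below). *)
Definition ent2 : set_system (Z2 * Z2) :=
  [set A | exists n, forall x y, res x n = res y n -> A (x, y)].

Fact ent2_filter : Filter ent2.
Proof.
split; first by exists 0%N.
- move=> A B [n An] [m Bm]; exists (maxn n m) => x y xy.
  have le k : (k <= maxn n m)%N -> res x k = res y k.
    move=> km; apply/eqP; rewrite -res_sub_eq0; apply/eqP.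
    by apply: res_eq0_le km _; apply/eqP; rewrite res_sub_eq0 xy.
  by split; [apply/An/le/leq_maxl | apply/Bm/le/leq_maxr].
- by move=> A B AB [n An]; exists n => x y /An /AB.
Qed.

Fact ent2_diagonal A : ent2 A -> diagonal `<=` A.
Proof. by move=> [n An] [x y] /= xy; apply: An; rewrite [x]xy. Qed.

Fact ent2_inv A : ent2 A -> ent2 (A^-1)%relation.
Proof. by move=> [n An]; exists n => x y xy; apply: An. Qed.

Fact ent2_split A : ent2 A -> exists2 B, ent2 B & (B \; B `<=` A)%relation.
Proof.
move=> [n An]; exists [set u | res u.1 n = res u.2 n]; first by exists n.
by move=> [x y] [z /= xz zy]; apply: An; rewrite xz.
Qed.

HB.instance Definition _ :=
  isUniform.Build Z2 ent2_filter ent2_diagonal ent2_inv ent2_split.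

Section metric.
Context (R : realType).

Fact dist2_ge0 x y : 0 <= dist2 R x y. Proof. exact: abs2_ge0. Qed.

Fact dist2_eq0 x y : dist2 R x y = 0 -> x = y.
Proof. by move=> /abs2_eq0/eqP; rewrite subr_eq0 => /eqP. Qed.

Fact ball2_center x (e : R) : 0 < e -> ball2 x e x.
Proof. by rewrite /ball2 /= /dist2 subrr abs20. Qed.

Fact ball2_sym x y (e : R) : ball2 x e y -> ball2 y e x.
Proof. by rewrite /ball2 /= /dist2 -(abs2N _ (x - y)) opprB. Qed.

Fact ball2_triangle x y z (e1 e2 : R) :
  ball2 x e1 y -> ball2 y e2 z -> ball2 x (e1 + e2) z.
Proof.
rewrite /ball2 /= /dist2 => xy yz; apply: (le_lt_trans _ (ltrD xy yz)).
by rewrite -(subrKA y); apply: abs2D.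
Qed.

Fact ent2E : entourage = entourage_ (@ball2 R) :> set_system (Z2 * Z2).
Proof.
apply/seteqP; split => A.
  move=> [n An]; exists (2 ^- n); first by rewrite /= invr_gt0 exprn_gt0.
  move=> [x y]; rewrite /ball2 /= => /ltW; rewrite /dist2 abs2_le res_sub_eq0.
  by move=> /eqP; apply: An.
move=> [e /= e0 eA].
have [n ne] : exists n, 2 ^- n < e :> R.
  exists (Num.truncn e^-1).+1; rewrite -[ltRHS]invrK.
  rewrite ltf_pV2 ?posrE ?invr_gt0 ?exprn_gt0 //.
  apply: (lt_le_trans (truncnS_gt _)).
  by rewrite -natrX ler_nat ltnW // ltn_expl.
exists n => x y xy; apply: eA; rewrite /ball2 /=; apply: le_lt_trans ne.
by rewrite /dist2 abs2_le res_sub_eq0 xy.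
Qed.

HB.instance Definition _ := Uniform_isPseudoMetric.Build R Z2
  ball2_center ball2_sym ball2_triangle ent2E.

Fact ball2E (x : Z2) (e : R) : ball x e = [set y | dist2 R x y < e].
Proof. by []. Qed.

HB.instance Definition _ :=
  PseudoMetric_isMetric.Build R Z2 dist2_ge0 dist2_eq0 ball2E.

End metric.

Definition coset2 (a : Z2) (n : nat) : set Z2 :=
  [set a + 2 ^+ n * z | z in [set: Z2]].

Section dynamics.
Context (R : realType) (X : metricType R) (f : X -> X).

Definition orbit_of (x : X) : set X := [set iter n f x | n in [set: nat]].

Definition periodic_pt (x : X) : Prop :=
  exists2 n : nat, (0 < n)%N & iter n f x = x.

Definition periodic_orbit (C : set X) : Prop :=
  exists2 x, periodic_pt x & C = orbit_of x.

Definition invariant_set (C : set X) : Prop := f @` C `<=` C.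

Definition finite_union_of_balls (C : set X) : Prop :=
  exists2 s : seq (X * R), all (fun b => 0 < b.2) s
                         & C = \bigcup_(b in [set` s]) ball b.1 b.2.

Definition minimal_component (C : set X) : Prop :=
  [/\ C !=set0, clopen C, finite_union_of_balls C, invariant_set C
    & forall x, C x -> C `<=` closure (orbit_of x)].

(* [edist_inf C y] is the distance from y to C, in the extended reals. *)
Definition in_attracting_basin (C : set X) (x : X) : Prop :=
  edist_inf C (iter n f x) @[n --> \oo] --> 0%E.

(* The at most countably many components are indexed by a countType. *)
Definition minimal_decomposition (I : countType)
    (P : set X) (M : I -> set X) (B : set X) : Prop :=
  let MM := \bigcup_i M i in
  [/\ P `|` MM `|` B = [set: X],
      [/\ P `&` MM = set0, P `&` B = set0, MM `&` B = set0
        & trivIset [set: I] M],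
      finite_set P /\ P = [set x | periodic_pt x],
      (forall i, minimal_component (M i)) /\
      (forall C, minimal_component C -> exists i, C = M i)
    & forall x, B x -> exists2 C,
        periodic_orbit C \/ (exists i, C = M i) & in_attracting_basin C x].

End dynamics.

Fixpoint fib_poly (A : comNzRingType) (m : nat) : {poly A} :=
  if m is k.+1 then
    if k is j.+1 then 'X * fib_poly A k + fib_poly A j else 1
  else 0.

(* The arithmetic takes place in nat, not in the ring 'I_8. *)
Definition M_comp (k : 'I_8) : set Z2 :=
  coset2 (1 + 2 * k)%:R 5
  `|` coset2 (29 + 22 * k + 20 * k ^ 2 + 24 * k ^ 3)%:R 5.

(* Main.v *)
Require Import Defs.
From mathcomp Require Import all_boot all_order all_algebra.
From mathcomp Require Import all_classical all_reals all_analysis.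
From mathcomp Require Import ring zify.

Set Implicit Arguments.
Unset Strict Implicit.
Unset Printing Implicit Defensive.

Import Order.TTheory GRing.Theory Num.Theory.

Local Open Scope classical_set_scope.
Local Open Scope ring_scope.

(** Write F for the polynomial F_m. Since m + 4 = 48(d + 1), the index m sits
    four steps before a multiple of 48, and this makes F explicit modulo 64 at
    odd points. Doubling F_n and F_(n+1) repeatedly from n = 6 shows that, for x
    odd, F_(48e)(x) = 0 and F_(48e+1)(x) = 1 + 32e modulo 64, while both
    derivatives vanish modulo 4 ([fib_6pow2_mod], [fib_48mul_mod]). Running the
    recurrence four steps backwards gives ([fib_sub4_mod64])

      F(x) = -(x^3 + 2x) + 32e  mod 64,    F'(x) = -1  mod 4.

    Modulo 32 this is an involution of the odd classes that sends 1 + 2k to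
    29 + 22k + 20k^2 + 24k^3, which is why M_k is invariant. Modulo 64 it is no
    longer one: the two terms 32e cancel in F o F because F' is odd, and what
    remains is F(F(x)) = x + 32 mod 64 ([fib2_odd_shift]). Moreover F o F has
    slope 1 modulo 4: it sends x + 32h to some F(F(x)) + 32h(1 + 4u)
    ([fib2_near_isometry]).

    These two properties pass to all levels ([lifting]): if g moves every point
    by an odd multiple of 2^n and has slope 1 modulo 4, then g o g moves every
    point by an odd multiple of 2^(n+1). Hence F o F acts as a single cycle
    on the classes modulo 2^n inside a given odd class modulo 32, for all n. So
    every orbit is dense in its M_k ([M_comp_dense]), and no odd point is
    periodic ([fib_odd_aperiodic]).

    At even points, F_(2n)(x) = nx modulo x^2 with n = m/2 even, so F(x) is a
    multiple of 2x and all orbits of even points converge to 0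
    ([fib_even_iter]). Finally a minimal component is the closure of the orbit
    of each of its points; if it contains an odd point it is therefore some M_k,
    and otherwise it contains 0 and equals {0}, which is not open
    ([minimal_component_fib]). *)

(** * Lifting of cycles from one power of 2 to the next *)

Section Lifting.
Context (A : comNzRingType) (l : nat) (S : set A).
Hypothesis S_coset : forall x t, S x -> S (x + 2 ^+ l * t).

(** This is what remains of the condition g' = 1 mod 4 when no derivative is
    available; unlike a polynomial expression, it is visibly stable under
    composition. *)
Definition near_isometry (g : A -> A) := forall x t, S x ->
  exists u, g (x + 2 ^+ l * t) = g x + 2 ^+ l * t * (1 + 4 * u).

Definition odd_shift (s : nat) (g : A -> A) := forall x, S x ->
  exists u, g x = x + 2 ^+ (l + s) * (1 + 2 * u).

Lemma odd_shift_stable s g x : odd_shift s g -> S x -> S (g x).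
Proof.
by move=> gs Sx; have [u ->] := gs x Sx; rewrite exprD -mulrA; apply: S_coset.
Qed.

Lemma near_isometry_comp s g h : odd_shift s g ->
  near_isometry g -> near_isometry h -> near_isometry (h \o g).
Proof.
move=> gs gi hi x t Sx /=; have [u ->] := gi x t Sx.
have [v] := hi (g x) (t * (1 + 4 * u)) (odd_shift_stable gs Sx).
by rewrite mulrA => ->; exists (u + v + 4 * u * v); ring.
Qed.

(** With h = g x - x, the second application moves the point by h(1 + 4u)
    again, so the total displacement is h(2 + 4u): exactly one more factor 2. *)
Lemma odd_shift_comp s g : odd_shift s g -> near_isometry g ->
  odd_shift s.+1 (g \o g).
Proof.
move=> gs gi x Sx /=; have [u gx] := gs x Sx.
have [v] := gi x (2 ^+ s * (1 + 2 * u)) Sx.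
rewrite mulrA -exprD -gx => ->; exists (u + v + 2 * u * v).
by rewrite gx addnS exprS; ring.
Qed.

Lemma lifting s g : odd_shift 0 g -> near_isometry g ->
  odd_shift s (iter (2 ^ s) g) /\ near_isometry (iter (2 ^ s) g).
Proof.
move=> g0 gi; elim: s => [|s [gs gis]]; first by [].
have -> : iter (2 ^ s.+1) g = iter (2 ^ s) g \o iter (2 ^ s) g.
  by apply/funext => x; rewrite expnS mul2n -addnn iterD.
by split; [apply: odd_shift_comp|apply: near_isometry_comp gs _ _].
Qed.

(** On the classes modulo [2 ^ (l + s + 1)], the [2 ^ s]-th iterate is the
    translation by [2 ^ (l + s)], hence its t-th power is the identity only for
    t even. *)
Lemma iter_shift s t g x : odd_shift 0 g -> near_isometry g -> S x ->
  exists u, iter (t * 2 ^ s) g x = x + 2 ^+ (l + s) * (t%:R + 2 * u).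
Proof.
move=> g0 gi Sx; have [gs _] := lifting s g0 gi.
elim: t => [|t [u IH]]; first by exists 0; rewrite /= mulr0 addr0 mulr0 addr0.
rewrite mulSn iterD IH.
have [|v ->] := gs (x + 2 ^+ (l + s) * (t%:R + 2 * u)).
  by rewrite exprD -mulrA; apply: S_coset.
by exists (u + v); rewrite -natr1; ring.
Qed.

(** A point already approached modulo [2 ^ (l + n)] is either approached modulo
    [2 ^ (l + n + 1)] as well, or becomes so after [2 ^ n] further steps. *)
Lemma orbit_dense n g x z :
    (forall w : A, (exists v, w = 2 * v) \/ exists v, w = 1 + 2 * v) ->
    odd_shift 0 g -> near_isometry g -> S x ->
  exists j w, x + 2 ^+ l * z = iter j g x + 2 ^+ (l + n) * w.
Proof.
move=> parity g0 gi Sx; elim: n => [|n [j [w IH]]].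
  by exists 0, z; rewrite addn0.
have Sj : S (iter j g x).
  by elim: (j) => //= i; apply: odd_shift_stable g0.
have [[v wE]|[v wE]] := parity w.
  by exists j, v; rewrite IH wE addnS exprS; ring.
have [u gu] := (lifting n g0 gi).1 _ Sj.
exists (2 ^ n + j)%N, (v - u); rewrite iterD gu IH wE addnS exprS; ring.
Qed.

End Lifting.

(** * Fibonacci polynomials modulo powers of 2 *)

Section Fibonacci.
Context (A : comNzRingType).
Implicit Types (x : A) (n k : nat).
Local Notation fp := (fib_poly A).

Lemma fib_polySS n : fp n.+2 = 'X * fp n.+1 + fp n.
Proof. by []. Qed.

Lemma fib_poly_add n k : fp (n + k).+1 = fp n.+1 * fp k.+1 + fp n * fp k.
Proof.
suff [] : fp (n + k).+1 = fp n.+1 * fp k.+1 + fp n * fp k /\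
   fp (n + k).+2 = fp n.+2 * fp k.+1 + fp n.+1 * fp k by [].
elim: n => [|n [IH1 IH2]].
  by rewrite !add0n !fib_polySS /=; split; ring.
rewrite addSn IH2; split=> //.
by rewrite fib_polySS IH1 IH2 !(fib_polySS n.+1) (fib_polySS n); ring.
Qed.

Lemma fib_poly_double n :
  fp n.*2 = fp n * (2 * fp n.+1 - 'X * fp n) /\
  fp n.*2.+1 = fp n.+1 ^+ 2 + fp n ^+ 2.
Proof.
split; last by rewrite -addnn fib_poly_add; ring.
case: n => [|n]; first by rewrite /= mul0r.
by rewrite -addnn addSn fib_poly_add (fib_polySS n); ring.
Qed.

Lemma horner_taylor2 (p : {poly A}) x h :
  exists r, p.[x + h] = p.[x] + h * p^`().[x] + h ^+ 2 * r.
Proof.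
elim/poly_ind: p => [|p c [r IH]].
  by exists 0; rewrite derivC !horner0; ring.
exists (p^`().[x] + (x + h) * r).
by rewrite derivD derivM derivX derivC !hornerE IH; ring.
Qed.

Lemma fib_near_0 n x : exists r s,
  (fp n.*2).[x] = n%:R * x + x ^+ 2 * r /\ (fp n.*2.+1).[x] = 1 + x * s.
Proof.
elim: n => [|n [r [s [IH1 IH2]]]].
  by exists 0, 0; rewrite /= !hornerE; split; ring.
exists (r + s), (s + n.+1%:R * x + x ^+ 2 * (r + s)).
rewrite doubleS (fib_polySS n.*2.+1) (fib_polySS n.*2) !hornerE IH1 IH2.
by rewrite -natr1; split; ring.
Qed.

(** Four steps of the recurrence, solved backwards; the coefficients are F_5 and
    F_4. *)
Lemma fib_poly_back n :
  fp n = ('X ^+ 4 + 3 * 'X ^+ 2 + 1) * fp (n + 4)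
         - ('X ^+ 3 + 2 * 'X) * fp (n + 5).
Proof. by rewrite !addnS addn0 !fib_polySS; ring. Qed.

Lemma fib_double_horner n x (a := (fp n).[x]) (b := (fp n.+1).[x])
    (a' := (fp n)^`().[x]) (b' := (fp n.+1)^`().[x]) :
  [/\ (fp n.*2).[x] = a * (2 * b - x * a),
      (fp n.*2.+1).[x] = b ^+ 2 + a ^+ 2,
      (fp n.*2)^`().[x] = 2 * (a' * b + a * b' - x * a * a') - a ^+ 2
    & (fp n.*2.+1)^`().[x] = 2 * (a * a' + b * b')].
Proof.
have [-> ->] := fib_poly_double n; rewrite /a /b /a' /b'.
move: (fp n) (fp n.+1) => P Q.
have h2 : (2 : {poly A}) = 2%:P by rewrite polyC_natr.
split; rewrite ?h2 ?hornerE //.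
- by rewrite derivM derivB !derivM derivX derivC !hornerE /=; ring.
- by rewrite derivD !expr2 !derivM !hornerE /=; ring.
Qed.

Lemma fib_add_horner n k x :
  (fp (n + k).+1).[x] = (fp n.+1).[x] * (fp k.+1).[x] + (fp n).[x] * (fp k).[x]
  /\ (fp (n + k).+1)^`().[x] =
     (fp n.+1)^`().[x] * (fp k.+1).[x] + (fp n.+1).[x] * (fp k.+1)^`().[x]
     + ((fp n)^`().[x] * (fp k).[x] + (fp n).[x] * (fp k)^`().[x]).
Proof. by rewrite fib_poly_add derivD !derivM !hornerE. Qed.

(** The period of the Fibonacci sequence doubles with the modulus. As x^2 is 1
    modulo 8, F_3(x) = x^2 + 1 is twice an odd number, which makes F_6(x)
    divisible by 8 and F_7(x) = 5 mod 8. Then, if F_n = 2^(j+1) p and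
    F_(n+1) = 1 + 2^j (odd) with j at least 2, the doubling formulas give the
    same with j + 1, and the derivatives gain a factor 2. *)
Lemma fib_6pow2_mod x t i : x ^+ 2 = 1 + 8 * t -> exists p r u v,
  [/\ (fp (6 * 2 ^ i)).[x] = 2 ^+ (i + 3) * p,
      (fp (6 * 2 ^ i).+1).[x] = 1 + 2 ^+ (i + 2) * (1 + 2 * r),
      (fp (6 * 2 ^ i))^`().[x] = 2 ^+ i.+1 * u
    & (fp (6 * 2 ^ i).+1)^`().[x] = 2 ^+ i.+1 * v].
Proof.
move=> xx; elim: i => [|i [p [r [u [v [IH1 IH2 IH3 IH4]]]]]].
  have f3 : (fp 3).[x] = 2 * (1 + 4 * t).
    by rewrite /= !hornerE -expr2 xx; ring.
  have f4 : (fp 4).[x] = x * (3 + 8 * t).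
    by rewrite fib_polySS hornerD hornerM hornerX f3 /= !hornerE /=; ring.
  have [/= -> -> -> ->] := fib_double_horner 3 x; rewrite f3 f4.
  set a' := (fp 3)^`().[x]; set b' := (fp 4)^`().[x].
  exists (x * (1 + 4 * t) * (1 + 2 * t)),
    (1 + 19 * t + 64 * t ^+ 2 + 64 * t ^+ 3),
    (a' * (x * (3 + 8 * t)) + 2 * (1 + 4 * t) * b' - x * (2 * (1 + 4 * t)) * a'
      - 2 * (1 + 4 * t) ^+ 2),
    (2 * (1 + 4 * t) * a' + x * (3 + 8 * t) * b').
  by split; rewrite ?exprMn ?xx; ring.
have [] := fib_double_horner (6 * 2 ^ i) x.
rewrite -mul2n mulnCA -expnS IH1 IH2 IH3 IH4 => -> -> -> ->.
set e : A := 2 ^+ i.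
(* The witnesses are the right-hand sides of the doubling formulas for
   F_n = 8ep, F_(n+1) = 1 + 4e(1 + 2r), F'_n = 2eu and F'_(n+1) = 2ev, divided
   by the powers of 2 that they contain. *)
exists (p * (1 + 4 * e * (1 + 2 * r) - 4 * x * e * p)),
  (r + e * (1 + 2 * r) ^+ 2 + 4 * e * p ^+ 2),
  (u * (1 + 4 * e * (1 + 2 * r)) + 8 * e * p * v
     - 8 * x * e * p * u - 16 * e * p ^+ 2),
  (8 * e * p * u + v * (1 + 4 * e * (1 + 2 * r))).
have eS n : 2 ^+ (i.+1 + n) = 2 * e * 2 ^+ n :> A by rewrite exprD exprS.
by split; rewrite ?eS ?exprS !exprD -/e; ring.
Qed.

Lemma fib_48mul_mod x t e : x ^+ 2 = 1 + 8 * t -> exists p r u v,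
  [/\ (fp (48 * e)).[x] = 64 * p, (fp (48 * e).+1).[x] = 1 + 32 * e%:R + 64 * r,
      (fp (48 * e))^`().[x] = 4 * u & (fp (48 * e).+1)^`().[x] = 4 * v].
Proof.
move=> xx; have [p [r [u [v []]]]] := fib_6pow2_mod 3 xx.
rewrite -[(6 * 2 ^ 3)%N]/48%N => P1 P2 P3 P4.
elim: e => [|e [p' [r' [u' [v' [IH1 IH2 IH3 IH4]]]]]].
  exists 0, 0, 0, 0; rewrite muln0 /= deriv0 -polyC1 derivC !hornerE.
  by split; rewrite ?addr0.
have [A1 A2] := fib_add_horner (48 * e) 47 x.
have [B1 B2] := fib_add_horner (48 * e) 48 x.
move: A1 A2 B1 B2; rewrite -addnS addnC -mulnS IH1 IH2 IH3 IH4 P1 P2 P3 P4.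
(* F_47 and its derivative are multiplied by F_(48e) and its derivative, which
   are 0 modulo 64 and 4. *)
move: (fp 47).[x] (fp 47)^`().[x] => a b -> -> -> ->.
exists ((1 + 32 * e%:R + 64 * r') * p + p' * a),
  (r' + r + 16 * (1 + 2 * r) * (e%:R + 2 * r') + 64 * p * p'),
  (64 * v' * p + 4 * (1 + 32 * e%:R + 64 * r') * u + u' * a + 16 * p' * b),
  (v' * (33 + 64 * r) + 4 * (1 + 32 * e%:R + 64 * r') * v + 64 * u' * p
   + 256 * p' * u).
by split; rewrite -?natr1; ring.
Qed.

(** As F_(n+4) is 0 and F_(n+5) is 1 + 32e modulo 64, only the coefficient
    x^3 + 2x of F_(n+5) contributes; it is odd, so it can be dropped from the
    term 32e. Likewise the derivative is -(3x^2 + 2) = -5 modulo 4. *)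
Lemma fib_sub4_mod64 x (k t : A) n e : x = 1 + 2 * k -> x ^+ 2 = 1 + 8 * t ->
  (n + 4 = 48 * e)%N -> exists z u,
  (fp n).[x] = - (x ^+ 3 + 2 * x) + 32 * e%:R + 64 * z /\
  (fp n)^`().[x] = -1 + 4 * u.
Proof.
move=> xk xx ne; have [p [r [u [v [P1 P2 P3 P4]]]]] := fib_48mul_mod e xx.
have n5 : (n + 5 = (48 * e).+1)%N by rewrite -ne !addnS.
have h2 : (2 : {poly A}) = 2%:P by rewrite polyC_natr.
pose al : {poly A} := 'X ^+ 4 + 3 * 'X ^+ 2 + 1.
pose be : {poly A} := 'X ^+ 3 + 2 * 'X.
have bx : be.[x] = x ^+ 3 + 2 * x by rewrite /be h2 !hornerE /=.
have dbx : be^`().[x] = 3 * x ^+ 2 + 2.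
  by rewrite /be h2 derivD derivM derivXn derivX derivC !hornerE /=; ring.
have fpE : fp n = al * fp (n + 4) - be * fp (n + 5) by exact: fib_poly_back.
(* Otherwise evaluation would unfold these two polynomials. *)
clearbody al be; rewrite fpE.
rewrite derivB !derivM !hornerE n5 ne P1 P2 P3 P4 bx dbx /=.
move: al.[x] al^`().[x] => a a'.
exists (a * p - r * (x ^+ 3 + 2 * x) - e%:R * (2 + 4 * t + k * (3 + 8 * t))),
  (16 * a' * p + a * u - 1 - 6 * t
   - (3 * x ^+ 2 + 2) * (8 * e%:R + 16 * r) - (x ^+ 3 + 2 * x) * v).
split.
  have -> : x ^+ 3 + 2 * x = x * (x ^+ 2 + 2) by ring.
  by rewrite xx xk; ring.
by rewrite xx; ring.
Qed.

End Fibonacci.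

(** The slope of F_(4n) at 0 is 2n, hence even. *)
Lemma fib_even_contract (A : comNzRingType) n0 (x : A) :
  exists u, (fib_poly A (2 * n0).*2).[2 * x] = 2 * (2 * x) * u.
Proof.
have [r [s [-> _]]] := fib_near_0 (2 * n0) (2 * x).
by exists (n0%:R + x * r); rewrite natrM; ring.
Qed.

Lemma fib_even_iter (A : comNzRingType) n0 (x : A) j :
  exists u, iter j (fun y => (fib_poly A (2 * n0).*2).[y]) (2 * x)
            = 2 ^+ j * (2 * x) * u.
Proof.
elim: j => [|j [u IH]]; first by exists 1; rewrite /=; ring.
rewrite iterS IH.
rewrite (_ : 2 ^+ j * (2 * x) * u = 2 * (2 ^+ j * x * u)); last by ring.
have [v ->] := fib_even_contract n0 (2 ^+ j * x * u).
by exists (u * v); rewrite exprS; ring.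
Qed.

(** * The action on odd points *)

Definition odds (A : comNzRingType) : set A :=
  [set x | exists k, x = 1 + 2 * k].
Arguments odds {A}.

Section OddDynamics.
Context (A : comNzRingType).
Implicit Types x h : A.
Hypothesis parity : forall w : A,
  (exists v, w = 2 * v) \/ exists v, w = 1 + 2 * v.
Context (n e : nat).
Hypothesis ne : (n + 4 = 48 * e)%N.
Let F := fun x : A => (fib_poly A n).[x].

(** An odd square is 1 modulo 8 because k(k + 1) is even. *)
Lemma odd_sqr x : odds x -> exists t, x ^+ 2 = 1 + 8 * t.
Proof.
move=> [k ->]; have [[v ->]|[v ->]] := parity k.
  by exists (v * (1 + 2 * v)); ring.
by exists ((1 + 2 * v) * (1 + v)); ring.
Qed.

Lemma fib_odd x : odds x -> exists z u,
  F x = - (x ^+ 3 + 2 * x) + 32 * e%:R + 64 * z /\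
  (fib_poly A n)^`().[x] = -1 + 4 * u.
Proof.
move=> ox; have [t xx] := odd_sqr ox; have [k xk] := ox.
exact: fib_sub4_mod64 xk xx ne.
Qed.

Lemma odds_coset x h : odds x -> odds (x + 2 ^+ 5 * h).
Proof. by move=> [k ->]; exists (k + 16 * h); ring. Qed.

Lemma fib_odds x : odds x -> odds (F x).
Proof.
move=> ox; have [z [_ [-> _]]] := fib_odd ox; have [k ->] := ox.
exists (-2 - 5 * k - 6 * k ^+ 2 - 4 * k ^+ 3 + 16 * e%:R + 32 * z); ring.
Qed.

(** Taylor's formula: on 32h, the quadratic term is absorbed by 4(32h). *)
Lemma fib_near_reflection x h : odds x ->
  exists u, F (x + 2 ^+ 5 * h) = F x + 2 ^+ 5 * - h * (1 + 4 * u).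
Proof.
move=> ox; have [_ [u [_ d]]] := fib_odd ox.
have [r] := horner_taylor2 (fib_poly A n) x (2 ^+ 5 * h).
rewrite d /F => ->; exists (- u - 8 * h * r); ring.
Qed.

Lemma fib2_near_isometry : near_isometry 5 odds (iter 2 F).
Proof.
move=> x h ox /=; have [u ->] := fib_near_reflection h ox.
have [v] := fib_near_reflection (- h * (1 + 4 * u)) (fib_odds ox).
by rewrite mulrA => ->; exists (u + v + 4 * u * v); ring.
Qed.

(** Put w = -(x^3 + 2x), so that F x = w + 32v with v = e modulo 2. Then
    F (F x) = -(w^3 + 2w) - 32v + 32e modulo 64. The last two terms cancel, and
    with x^2 = 1 + 8t one finds -(w^3 + 2w) = 33x = x + 32. *)
Lemma fib2_odd_shift : odd_shift 5 odds 0 (iter 2 F).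
Proof.
move=> x ox /=; have [t xx] := odd_sqr ox; have [k xk] := ox.
have [z [_ [Fx _]]] := fib_odd ox.
have [z' [_ [-> _]]] := fib_odd (fib_odds ox).
pose w := - x * (3 + 8 * t).
have wx : - (x ^+ 3 + 2 * x) = w.
  by rewrite exprS xx /w; ring.
have ww : w ^+ 2 = 9 + 8 * (15 * t + 56 * t ^+ 2 + 64 * t ^+ 3).
  by rewrite exprMn sqrrN xx; ring.
pose v := e%:R + 2 * z.
pose c := 7 * t + 36 * t ^+ 2 + 80 * t ^+ 3 + 64 * t ^+ 4.
exists (k + x * c - v * (14 + 180 * t + 672 * t ^+ 2 + 768 * t ^+ 3)
        - 48 * w * v ^+ 2 - 512 * v ^+ 3 + z' - z).
have -> : F x = w + 32 * v by rewrite Fx wx /v; ring.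
have -> : (w + 32 * v) ^+ 3 + 2 * (w + 32 * v) =
    w * (w ^+ 2 + 2) + 32 * v * (3 * w ^+ 2 + 2)
    + 64 * (48 * w * v ^+ 2 + 512 * v ^+ 3) by ring.
rewrite ww /w /c /v xk; ring.
Qed.

End OddDynamics.

(** * Residues and topology of the 2-adic integers *)

Section Z2Facts.
Implicit Types (x y : Z2) (n : nat).

Lemma res_natr a n : res (a%:R) n = (a %% 2 ^ n)%N.
Proof.
elim: a => [|a IH]; first by rewrite res0 mod0n.
by rewrite -natr1 resD IH modnDml [res 1 n]/= modnDmr addn1.
Qed.

Lemma res_le x m n : (m <= n)%N -> (res x n %% 2 ^ m)%N = res x m.
Proof.
move=> /subnK <-; elim: (n - m)%N => [|k IH]; first exact: res_mod.
rewrite -IH [in RHS]resS modn_dvdm //; exact/dvdn_exp2l/leq_addl.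
Qed.

Lemma res_dvd x n : res x n = 0%N -> exists z, x = 2 ^+ n * z.
Proof.
move=> x0.
have zP k : (res x (k + n) %/ 2 ^ n =
    (res x (k.+1 + n) %/ 2 ^ n) %% 2 ^ k)%N.
  by rewrite modn_divl -expnD res_le ?leq_add2r.
exists (MkZ2 zP); apply: Z2P => k.
rewrite resM -natrX res_natr modnMml /= mulnC divnK; last first.
  by rewrite /dvdn res_le ?leq_addl ?x0.
by rewrite res_le ?leq_addr.
Qed.

Lemma res_eqP x y n : res x n = res y n <-> exists z, x = y + 2 ^+ n * z.
Proof.
split=> [/eqP|[z ->]].
  rewrite -res_sub_eq0 => /eqP /res_dvd [z xy].
  by exists z; rewrite -xy addrC subrK.
by rewrite resD resM -natrX res_natr modnn mul0n mod0n addn0 res_mod.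
Qed.

Lemma coset2P (a : nat) n x : coset2 a%:R n x <-> res x n = (a %% 2 ^ n)%N.
Proof.
rewrite -res_natr res_eqP; split=> [[z _ <-]|[z ->]]; by exists z.
Qed.

Lemma Z2_parity x : (exists v, x = 2 * v) \/ exists v, x = 1 + 2 * v.
Proof.
have := res_lt x 1; case E: (res x 1) => [|[|//]] _; [left|right].
  by have [z ->] := res_dvd E; exists z; rewrite expr1.
have : res x 1 = res 1 1 by rewrite E.
by move=> /res_eqP [z ->]; exists z; rewrite expr1.
Qed.

Lemma res1_odd v : res (1 + 2 * v) 1 = 1%N.
Proof. by rewrite resD resM (res_natr 2) modnn mul0n mod0n addn0. Qed.

Lemma nbhs_Z2 x (B : set Z2) :
  nbhs x B <-> exists n, forall y, res x n = res y n -> B y.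
Proof.
rewrite -filter_from_entourageE; split=> [[E [n En] EB]|[n Bn]].
  by exists n => y xy; apply: EB; rewrite /xsection /= inE; apply: En.
exists [set p | res p.1 n = res p.2 n]; first by exists n.
by move=> y; rewrite /xsection /= inE => xy; apply: Bn.
Qed.

Lemma closure_Z2 (B : set Z2) x :
  closure B x <-> forall n, exists2 y, B y & res x n = res y n.
Proof.
split=> [cl n|cl U /nbhs_Z2 [n Un]].
  have [|y [By xy]] := cl [set y | res x n = res y n]; last by exists y.
  by apply/nbhs_Z2; exists n.
by have [y By xy] := cl n; exists y; split=> //; apply: Un.
Qed.

Lemma clopen_res n (P : set nat) : clopen [set x : Z2 | P (res x n)].
Proof.
have op Q : open [set x : Z2 | Q (res x n)].
  by rewrite openE => x Qx; apply/nbhs_Z2; exists n => y /= <-.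
split; first exact: op.
by rewrite -openC; apply: (op (~` P)).
Qed.

End Z2Facts.

(** The values of the distance are powers of 2, so a strict bound by 2^-n is a
    weak bound by 2^-(n+1). *)
Lemma ball_coset (R : realType) (a : Z2) n :
  ball a (2 ^- n : R) = [set x : Z2 | res x n.+1 = res a n.+1].
Proof.
have e0 k : 0 < 2 ^- k :> R by rewrite invr_gt0 exprn_gt0.
rewrite ball2E; apply/seteqP; split=> x /=; rewrite /dist2.
  rewrite /abs2; case: pselect => [h|h _]; last first.
    apply/esym/eqP; rewrite -res_sub_eq0; apply: contra_notT h => h.
    by exists n.
  case: ex_minnP => m hm mmin.
  rewrite ltf_pV2 ?posrE ?exprn_gt0 // ltr_eXn2l ?ltr1n // => nm.
  apply/esym/eqP; rewrite -res_sub_eq0.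
  by apply: contraTT nm => /mmin; rewrite -leqNgt.
move=> /esym/eqP; rewrite -res_sub_eq0 -(abs2_le R) => /le_lt_trans; apply.
by rewrite ltf_pV2 ?posrE ?exprn_gt0 // ltr_eXn2l ?ltr1n.
Qed.

(** * The components and their residues modulo 32 *)

(** The list tabulates 29 + 22k + 20k^2 + 24k^3 modulo 32, which turns covering
    and disjointness of the components into checks on small numbers. *)
Definition M_residues (k : nat) : seq nat :=
  [:: (1 + 2 * k)%N; nth 0%N [:: 29; 31; 25; 27; 21; 23; 17; 19]%N k].

Lemma M_compE (k : 'I_8) : M_comp k = [set x | res x 5 \in M_residues k].
Proof.
have [ha hb] : ((1 + 2 * k) %% 2 ^ 5 = nth 0 (M_residues k) 0 /\
  (29 + 22 * k + 20 * k ^ 2 + 24 * k ^ 3) %% 2 ^ 5 = nth 0 (M_residues k) 1)%N.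
  by case: k; do 8! [case=> //].
apply/seteqP; split=> x /=; rewrite /M_comp /= !inE.
  case=> /coset2P ->; rewrite ?ha ?hb /= eqxx ?orbT //.
by case/orP=> /eqP xr; [left|right]; apply/coset2P; rewrite ?ha ?hb.
Qed.

Lemma M_residues_cover r : (r < 32)%N -> odd r ->
  exists k : 'I_8, r \in M_residues k.
Proof.
move=> r32 ro.
have /allP/(_ r) : all (fun r => odd r ==> has (fun k => r \in M_residues k)
  (iota 0 8)) (iota 0 32) by [].
rewrite mem_iota r32 ro => /(_ isT) /hasP [k].
by rewrite mem_iota => /andP[_ k8] rk; exists (Ordinal k8).
Qed.

Lemma M_residues_disj (i j : 'I_8) r :
  r \in M_residues i -> r \in M_residues j -> i = j.
Proof.
have /allP/(_ i) : all (fun i => all (fun j =>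
    has (mem (M_residues i)) (M_residues j) ==> (i == j))
  (iota 0 8)) (iota 0 8) by [].
rewrite mem_iota ltn_ord => /(_ isT) /allP /(_ j).
rewrite mem_iota ltn_ord => /(_ isT) /implyP ij ri rj.
by apply/val_inj/eqP/ij; apply/hasP; exists r.
Qed.

Lemma M_comp_disj i j x : M_comp i x -> M_comp j x -> i = j.
Proof. by rewrite !M_compE; apply: M_residues_disj. Qed.

Lemma oddsP (x : Z2) : odds x <-> res x 1 = 1%N.
Proof.
split=> [[k ->]|x1]; first exact: res1_odd.
have [[v xv]|//] := Z2_parity x.
by move: x1; rewrite xv resM (res_natr 2) modnn mul0n.
Qed.

Lemma evensP (x : Z2) : ~ odds x <-> exists z, x = 2 * z.
Proof.
split=> [no|[z ->] /oddsP]; first by have [|] := Z2_parity x.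
by rewrite resM (res_natr 2) modnn mul0n.
Qed.

Lemma bigcup_M_comp : \bigcup_k M_comp k = odds.
Proof.
apply/seteqP; split=> x.
  by case=> k _ [] [z _ <-]; [exists (k%:R + 16 * z)|
   exists (14 + 11 * k%:R + 10 * k%:R ^+ 2 + 12 * k%:R ^+ 3 + 16 * z)]; ring.
move=> /oddsP x1.
have [|k xk] := @M_residues_cover (res x 5) (res_lt x 5).
  by rewrite -(@odd_mod _ (2 ^ 1)) // res_le // x1.
by exists k => //; rewrite M_compE.
Qed.

(** * Orbits of the Fibonacci map *)

Section Main.
Context (n e : nat).
Implicit Types x y : Z2.
Hypothesis ne : (n + 4 = 48 * e)%N.
Let F := fun x : Z2 => (fib_poly Z2 n).[x].

(** The second representative is 32(1 + k + k^2 + k^3) - (a^3 + 2a) at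
    a = 1 + 2k. *)
Lemma fib_coset_image k x : coset2 (1 + 2 * k)%:R 5 x ->
  coset2 (29 + 22 * k + 20 * k ^ 2 + 24 * k ^ 3)%:R 5 (F x).
Proof.
move=> [z _ xz].
have ox : odds x by rewrite -xz; exists (k%:R + 16 * z); ring.
have [w [_ [Fx _]]] := fib_odd Z2_parity ne ox.
pose c : Z2 := 1 + 2 * k%:R.
exists (- 1 - k%:R - k%:R ^+ 2 - k%:R ^+ 3 + e%:R + 2 * w
        - (3 * c ^+ 2 * z + 96 * c * z ^+ 2 + 1024 * z ^+ 3 + 2 * z)) => //.
by rewrite /F Fx -xz /c; ring.
Qed.

(** The second class is the image of the first, and F o F is the identity
    modulo 32. *)
Lemma fib_coset_back k x :
  coset2 (29 + 22 * k + 20 * k ^ 2 + 24 * k ^ 3)%:R 5 x ->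
  coset2 (1 + 2 * k)%:R 5 (F x).
Proof.
move=> [z _ xz]; pose a : Z2 := (1 + 2 * k)%:R.
have oa : odds a by exists k%:R; rewrite /a; ring.
have [|z' _ Fa] := @fib_coset_image k a.
  by exists 0; rewrite ?mulr0 ?addr0.
have xF : x = F a + 2 ^+ 5 * (z - z') by rewrite -Fa -xz; ring.
have oFa := fib_odds Z2_parity ne oa.
have [u] := fib_near_reflection Z2_parity ne (z - z') oFa.
have [v] := fib2_odd_shift Z2_parity ne oa.
rewrite /= -/(F a) -xF => -> Fx.
exists (1 + 2 * v - (z - z') * (1 + 4 * u)) => //.
by rewrite /F Fx; rewrite /a; ring.
Qed.

Lemma fib_M_comp k x : M_comp k x -> M_comp k (F x).
Proof. by case=> [/fib_coset_image|/fib_coset_back]; [right|left]. Qed.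

Lemma iter_M_comp k x j : M_comp k x -> M_comp k (iter j F x).
Proof. by move=> kx; elim: j => //= j; apply: fib_M_comp. Qed.

Lemma coset_iter_dense x y N : odds x -> res y 5 = res x 5 ->
  exists j, res (iter j F x) N = res y N.
Proof.
move=> ox /res_eqP [z ->].
have [j [w ->]] := orbit_dense (@odds_coset _) N z Z2_parity
  (fib2_odd_shift Z2_parity ne) (fib2_near_isometry Z2_parity ne) ox.
exists (j * 2)%N; rewrite iterM; apply/esym/res_eqP; exists (2 ^+ 5 * w).
by rewrite exprD; ring.
Qed.

Lemma M_comp_dense k x y N : M_comp k x -> M_comp k y ->
  exists j, res (iter j F x) N = res y N.
Proof.
have odd_k w : M_comp k w -> odds w.
  by move=> kw; rewrite -bigcup_M_comp; exists k.
move=> kx ky.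
suff [/coset_iter_dense|yx] : res y 5 = res x 5 \/ res y 5 = res (F x) 5.
- by apply; apply: odd_k kx.
- have [|j jN] := coset_iter_dense N _ yx; first exact/odd_k/fib_M_comp.
  by exists j.+1; rewrite iterSr.
case: kx ky => kx [] /coset2P ->.
- by left; apply/esym/coset2P.
- by right; apply/esym/coset2P/fib_coset_image.
- by right; apply/esym/coset2P/fib_coset_back.
- by left; apply/esym/coset2P.
Qed.

(** If the period is [t * 2 ^ s] with t odd, then the t-th power of the
    [2 ^ s]-th iterate of F o F moves x by an odd multiple of [2 ^ (5 + s)]. *)
Lemma fib_odd_aperiodic x N : odds x -> (0 < N)%N -> iter N F x <> x.
Proof.
move=> ox N0 xN.
have [t] := pfactor_coprime (isT : prime 2) N0.
rewrite coprime2n; move: (logn 2 N) => s to Nts.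
have := iter_shift (@odds_coset _) s t (fib2_odd_shift Z2_parity ne)
  (fib2_near_isometry Z2_parity ne) ox.
rewrite -Nts -iterM mulnC iterM /= xN xN => -[u].
rewrite -[LHS]addr0 => /addrI /esym shift0.
have : res (2 ^+ (5 + s) : Z2) (5 + s).+1 = res 0 (5 + s).+1.
  apply/res_eqP; exists (- (t./2)%:R - u).
  have tE : t%:R = 1 + 2 * (t./2)%:R :> Z2.
    by rewrite -[in LHS](odd_double_half t) to -mul2n natrD natrM.
  by rewrite add0r exprS -[LHS]subr0 -shift0 tE; ring.
rewrite res0 -natrX res_natr modn_small ?ltn_exp2l // => /eqP.
by rewrite expn_eq0.
Qed.

Lemma even_iter x N : ~ odds x -> exists u, iter N F x = 2 ^+ N * x * u.
Proof.
move=> /evensP [z ->].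
have -> : F = fun y => (fib_poly Z2 (2 * (12 * e - 1)).*2).[y].
  by rewrite /F (_ : n = (2 * (12 * e - 1)).*2) //; lia.
exact: fib_even_iter.
Qed.

Lemma even_iter_res x N : ~ odds x -> res (iter N F x) N = 0%N.
Proof.
move=> /(even_iter N)[u ->].
apply: etrans (res0 N); apply/res_eqP; exists (x * u).
by rewrite add0r mulrA.
Qed.

Lemma fib_0 : F 0 = 0.
Proof.
have e0 : ~ odds (0 : Z2) by apply/evensP; exists 0; rewrite mulr0.
by have [u] := even_iter 1 e0; rewrite mulr0 mul0r.
Qed.

Lemma iter_fib_0 j : iter j F 0 = 0.
Proof. by elim: j => //= j ->; apply: fib_0. Qed.

(** * Periodic points, basin and minimal components *)

Section Metric.
Context (R : realType).

Lemma orbit_fib_0 : orbit_of (R := R) F 0 = [set 0].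
Proof.
apply/seteqP; split=> [y [j _ <-]|y ->] /=; first exact: iter_fib_0.
by exists 0%N.
Qed.

(** An even periodic point x satisfies x = 2yx for some y, so it is divisible by
    every power of 2. *)
Lemma periodic_fib x : periodic_pt (R := R) F x <-> x = 0.
Proof.
split=> [[N N0 xN]|->]; last by exists 1%N; rewrite //= fib_0.
have [ox|ex] := pselect (odds x); first by have := fib_odd_aperiodic ox N0 xN.
have [u] := even_iter N ex; rewrite xN => xu.
have x2 : x = 2 * (2 ^+ N.-1 * u) * x.
  by rewrite {1}xu -{1}(prednK N0) exprS; ring.
apply: Z2P => i; rewrite res0; elim: i => [|i IH]; first exact: res0n.
have [z xz] := res_dvd IH.
apply: etrans (res0 i.+1); apply/res_eqP; exists (2 ^+ N.-1 * u * z).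
by rewrite {1}x2 xz exprS; ring.
Qed.

(** The distance to a set is continuous and vanishes on the set, so convergence
    of the orbit to 0 is enough. *)
Lemma even_attracted x : ~ odds x -> in_attracting_basin (R := R) F [set 0] x.
Proof.
move=> ex; rewrite /in_attracting_basin.
have it0 : iter j F x @[j --> \oo] --> (0 : Z2).
  move=> U /nbhs_Z2 [N NU]; exists N => // j /= Nj; apply: NU.
  by rewrite res0; apply/esym; apply: res_eq0_le Nj (even_iter_res j ex).
rewrite -(edist_inf0 (R := R) (A := [set (0 : Z2)]) erefl).
by apply: continuous_cvg it0; apply: edist_inf_continuous.
Qed.

Lemma M_comp_closure_orbit k x : M_comp k x ->
  M_comp k `<=` closure (orbit_of (R := R) F x).
Proof.
move=> kx y ky; apply/closure_Z2 => N.
have [j jN] := M_comp_dense N kx ky.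
by exists (iter j F x) => //; exists j.
Qed.

Lemma clopen_M_comp k : clopen (M_comp k).
Proof.
by rewrite M_compE; apply: (@clopen_res 5 [set r | r \in M_residues k]).
Qed.

Lemma balls_M_comp k : finite_union_of_balls (R := R) (M_comp k).
Proof.
exists [seq (r%:R, 2 ^- 4) | r <- M_residues k].
  by rewrite /= !invr_gt0 !exprn_gt0.
have Mk r : r \in M_residues k -> (r %% 2 ^ 5 = r)%N.
  have /allP/(_ k) : all (fun k => all (fun r => r %% 2 ^ 5 == r)
    (M_residues k))%N (iota 0 8) by [].
  by rewrite mem_iota ltn_ord => /(_ isT) /allP rP /rP /eqP.
rewrite M_compE; apply/seteqP; split=> x.
  move=> xk; exists ((res x 5)%:R, 2 ^- 4).
    exact: (map_f (fun r => (r%:R, _))).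
  by rewrite ball_coset /= res_natr res_mod.
case=> b /(@mapP _ _ _ (M_residues k)) [r rk ->].
rewrite ball_coset /= res_natr Mk // => ->.
exact: rk.
Qed.

Lemma minimal_M_comp k : minimal_component (R := R) F (M_comp k).
Proof.
split; [|exact: clopen_M_comp|exact: balls_M_comp|
  |exact: M_comp_closure_orbit].
  by exists (1 + 2 * k)%:R; left; exists 0; rewrite ?mulr0 ?addr0.
by move=> _ [x kx <-]; apply: fib_M_comp.
Qed.

(** By minimality and closedness, a component is the closure of the orbit of any
    of its points. *)
Lemma minimal_component_fib C : minimal_component (R := R) F C ->
  exists k, C = M_comp k.
Proof.
case=> -[x Cx] [Co Cc] _ FC Cmin.
have orbC y : C y -> orbit_of (R := R) F y `<=` C.
  by move=> Cy _ [j _ <-]; elim: j => //= j IH; apply: FC; exists (iter j F y).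
have clC y : C y -> closure (orbit_of (R := R) F y) `<=` C.
  by move=> Cy; rewrite [X in _ `<=` X](closure_id C).1 //; apply/closureS/orbC.
have [ox|ex] := pselect (odds x).
  have [k _ kx] : (\bigcup_k M_comp k) x by rewrite bigcup_M_comp.
  exists k; apply/seteqP; split; last first.
    exact: subset_trans (M_comp_closure_orbit kx) (clC x Cx).
  apply: (subset_trans (Cmin x Cx)).
  rewrite [X in _ `<=` X](closure_id _).1; last exact: (clopen_M_comp k).2.
  by apply: closureS => _ [j _ <-]; apply: iter_M_comp.
have C0 : C 0.
  apply: (clC x Cx); apply/closure_Z2 => N.
  exists (iter N F x); first by exists N.
  by rewrite res0 even_iter_res.
(* An open component would contain 2^N for N large, which is not in the closure
   of the orbit of 0. *)
have /nbhs_Z2 [N NC] : nbhs (0 : Z2) C by apply: open_nbhs_nbhs.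
have CN : C (2 ^+ N) by apply: NC; rewrite res0 -natrX res_natr modnn.
have := Cmin 0 C0 _ CN; rewrite orbit_fib_0 => /closure_Z2 /(_ N.+1) [_ ->].
rewrite res0 -natrX res_natr modn_small ?ltn_exp2l // => /eqP.
by rewrite expn_eq0.
Qed.

End Metric.
End Main.

Theorem theorem8p5 (R : realType) (d q m : nat)
    (hq : q = (3 + 4 * d)%N) (hm : m = (8 + 12 * q)%N) :
  let F := fun x : Z2 => (fib_poly Z2 m).[x] in
  let B := [set 2 * z | z in [set: Z2]] `\` [set 0] in
  [/\ minimal_decomposition (R := R) F [set 0] M_comp B,
      F 0 = 0
    & forall x : Z2, B x -> in_attracting_basin (R := R) F [set 0] x].
Proof.
move=> F B; have me : (m + 4 = 48 * d.+1)%N by lia.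
have Beven x : B x -> ~ odds x.
  by case=> -[z _ <-] _; apply/evensP; exists z.
have zero_even : ~ odds (0 : Z2) by apply/evensP; exists 0; rewrite mulr0.
have Battr x : B x -> in_attracting_basin (R := R) F [set 0] x.
  by move=> /Beven; apply: even_attracted me R x.
split=> //; last exact: fib_0 me.
split; rewrite ?bigcup_M_comp.
- apply/seteqP; split=> // x _; have [ox|ex] := pselect (odds x).
    by left; right.
  have [->|/eqP x0] := eqVneq x 0; first by left; left.
  by right; split=> //; have /evensP [z ->] := ex; exists z.
- split.
  + by apply/seteqP; split=> // x [-> /zero_even].
  + by apply/seteqP; split=> // x [-> [_ /(_ erefl)]].
  + by apply/seteqP; split=> // x [ox /Beven].
  + by move=> i j _ _ [x [ix jx]]; apply: M_comp_disj ix jx.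
- split; first exact: finite_set1.
  by apply/seteqP; split=> x /(periodic_fib me R).
- split; first exact: minimal_M_comp me R.
  exact: minimal_component_fib me R.
- move=> x Bx; exists [set 0]; last exact: Battr.
  left; exists 0; first exact/(periodic_fib me R).
  by rewrite (orbit_fib_0 me).
Qed.
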